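(* Let $K$ and $E$ be finite-dimensional associative unital algebras over $\mathbb{C}$, with dual coalgebras $L=K^*$ and $F=E^*$, and let $x: L\to \mathrm{Invd}(F)$ be a linear map, with associated algebra morphism $\pi_x:T(L)\to \mathrm{Invd}(T(F))$, whose image is $U_x$. Let $\pi_x^1:T(L)\to \mathrm{Invd}(F)$ be the morphism $\pi_x^1(w)=\pi_x(w)|_F$. For an integer $n\ge 0$ let $R_n^1=T_n(L)\cap\ker\pi_x^1$, let $W_n\subset T_n(K)$ be the orthogonal of $R_n^1$ in the dual $T_n(K)$ of $T_n(L)$, and let $B(W_n)$ be the smallest subalgebra of $T_n(K)$ containing $W_n$ and the unit of $T_n(K)$. Then the orthogonal of $B(W_n)$ in $T_n(L)$ is the coideal of relations of order $n$, namely $R_n(U_x)=T_n(L)\cap\ker\pi_x$.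
   Context: All coalgebras are coassociative with counit, over $\mathbb{C}$. For a coalgebra $C$ with coproduct $\Delta_C$, $\mathrm{Invd}(C)$ denotes the algebra of right-invariant operators, i.e. the $A\in \mathrm{End}(C)$ with $\Delta_C\circ A=(A\otimes \mathrm{id})\circ\Delta_C$. The tensor algebra $T(L)=\mathbb{C}\oplus L\oplus (L\otimes L)\oplus\cdots$ is a bialgebra whose coproduct $\Delta_L$ and counit $\epsilon_L$ are the unique unital algebra morphisms extending those of $L$; similarly $T(F)$ with $\Delta_F,\epsilon_F$. $T_n(L)=\mathbb{C}\oplus L\oplus\cdots\oplus\otimes^nL$ is a subcoalgebra of $T(L)$. $T_n(K)=\mathbb{C}\oplus K\oplus\cdots\oplus\otimes^nK$ is considered as the dual of $T_n(L)$ (pairing $\otimes^iK$ with $\otimes^iL$ factor by factor, and $\otimes^iK$ with $\otimes^jL$ to zero for $i\neq j$), with the algebra structure dual to the coalgebra structure of $T_n(L)$; that is, $T_n(K)$ is the direct product of the algebras $\otimes^iK$, $0\le i\le n$ (with $\otimes^0K=\mathbb{C}$), each with its tensor product algebra structure. This is not the (truncated) tensor algebra multiplication. Orthogonals are taken with respect to this pairing. For $l\in L$, the operator $X(l)$ on $T(F)$ is determined by: $X(l)(1)=\epsilon_L(l)1$; $X(l)(f)=x(l)(f)$ for $f\in F$; and $X(l)(w_1w_2)=\sum_k X(l_k')(w_1)\,X(l_k'')(w_2)$ for $w_1,w_2\in T(F)$, where $\Delta_L(l)=\sum_k l_k'\otimes l_k''$. It is known that $X(l)\in \mathrm{Invd}(T(F))$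 and that $X(l)(\otimes^nF)\subset\otimes^nF$ for all $n$. The map $\pi_x:T(L)\to \mathrm{Invd}(T(F))\subset \mathrm{End}(T(F))$ is the unital algebra morphism (product in the target is composition) with $\pi_x(l)=X(l)$ for $l\in L$. *)

(* Defs.v *)
From HB Require Import structures.
From mathcomp Require Import all_boot all_order all_algebra all_field.
From mathcomp Require Import finmap complex.
From mathcomp Require Import classical_sets reals.
From mathcomp Require Import monalg.

Set Implicit Arguments.
Unset Strict Implicit.
Unset Printing Implicit Defensive.

Import GRing.Theory.

Local Open Scope classical_set_scope.
Local Open Scope ring_scope.

Section TensorProduct.
Context (k : fieldType).

Definition bas (V : vectType k) (i : 'I_(\dim {:V})) : V := (vbasis {:V})`_i.

Definition crd (V : vectType k) (i : 'I_(\dim {:V})) : V -> k :=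
  coord (vbasis {:V}) i.

Lemma bas_sum (V : vectType k) (v : V) : v = \sum_i crd i v *: bas i.
Proof. exact: coord_vbasis (memvf v). Qed.

Lemma crd_bas (V : vectType k) (i j : 'I_(\dim {:V})) :
  crd i (bas j) = (i == j)%:R.
Proof. by rewrite eq_sym; apply: coord_free; apply: basis_free (vbasisP _). Qed.

Lemma crdP (V : vectType k) (i : 'I_(\dim {:V})) c (u v : V) :
  crd i (c *: u + v) = c * crd i u + crd i v.
Proof. exact: linearP. Qed.

(* V (x) W, in coordinates with respect to the vectors bas i (x) bas j. *)
Definition tens (V W : vectType k) := 'M[k]_(\dim {:V}, \dim {:W}).

Definition pure (V W : vectType k) (v : V) (w : W) : tens V W :=
  \matrix_(i, j) (crd i v * crd j w).

(* The linear map V (x) W -> U induced by a bilinear map b : V -> W -> U. *)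
Definition tlift (V W : vectType k) (U : lmodType k) (b : V -> W -> U)
    (t : tens V W) : U :=
  \sum_i \sum_j t i j *: b (bas i) (bas j).

Definition bilin (V W U : lmodType k) (b : V -> W -> U) : Prop :=
  (forall v, linear (b v)) /\ (forall w, linear (b^~ w)).

Lemma tlift_pure (V W : vectType k) (U : lmodType k) (b : V -> W -> U) v w :
  bilin b -> tlift b (pure v w) = b v w.
Proof.
move=> [br bl].
pose brM v : {linear W -> U} :=
  HB.pack (b v) (GRing.isLinear.Build _ _ _ _ (b v) (br v)).
pose blM w : {linear V -> U} :=
  HB.pack (b^~ w) (GRing.isLinear.Build _ _ _ _ (b^~ w) (bl w)).
rewrite {2}[v]bas_sum -[b _ w]/(blM w _) linear_sum /=; apply: eq_bigr => i _.
rewrite -[b _ w]/(blM w _) linearZ /= {2}[w]bas_sum.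
rewrite -[b _ (\sum_i _)]/(brM (bas i) _) linear_sum scaler_sumr /=.
apply: eq_bigr => j _; rewrite -[b _ (_ *: _)]/(brM (bas i) _) linearZ /=.
by rewrite scalerA mxE.
Qed.

Lemma tlift_linear (V W : vectType k) (U : lmodType k) (b : V -> W -> U) :
  linear (tlift b).
Proof.
move=> c s t; rewrite /tlift scaler_sumr -big_split; apply: eq_bigr => i _.
rewrite scaler_sumr -big_split; apply: eq_bigr => j _ /=.
by rewrite !mxE scalerDl scalerA.
Qed.

Lemma eq_tlift (V W : vectType k) (U : lmodType k) (b b' : V -> W -> U) t :
  (forall v w, b v w = b' v w) -> tlift b t = tlift b' t.
Proof.
by move=> bb'; apply: eq_bigr => i _; apply: eq_bigr => j _; rewrite bb'.
Qed.

Lemma tlift_lincomb (V W : vectType k) (U : lmodType k) (b b' : V -> W -> U) c t :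
  tlift (fun v w => c *: b v w + b' v w) t = c *: tlift b t + tlift b' t.
Proof.
rewrite /tlift scaler_sumr -big_split; apply: eq_bigr => i _ /=.
rewrite scaler_sumr -big_split; apply: eq_bigr => j _ /=.
by rewrite scalerDr !scalerA mulrC.
Qed.

Lemma lin_bas (V : vectType k) (U : lmodType k) (f : V -> U) v :
  linear f -> f v = \sum_i crd i v *: f (bas i).
Proof.
move=> lf; pose F : {linear V -> U} :=
  HB.pack f (GRing.isLinear.Build _ _ _ _ f lf).
rewrite {1}[v]bas_sum -[LHS]/(F _) linear_sum; apply: eq_bigr => i _.
by rewrite linearZ.
Qed.

Lemma lin_tlift (V W : vectType k) (U U' : lmodType k) (f : U -> U')
    (b : V -> W -> U) t :
  linear f -> f (tlift b t) = tlift (fun v w => f (b v w)) t.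
Proof.
move=> lf; pose F : {linear U -> U'} :=
  HB.pack f (GRing.isLinear.Build _ _ _ _ f lf).
rewrite -[LHS]/(F _) linear_sum; apply: eq_bigr => i _.
by rewrite linear_sum; apply: eq_bigr => j _; rewrite linearZ.
Qed.

(* (A (x) id) on C (x) C is  tlift (fun u v => pure (A u) v). *)
Definition invd (C : vectType k) (Delta : C -> tens C C) (A : 'End(C)) : Prop :=
  forall c, Delta (A c) = tlift (fun u v => pure (A u) v) (Delta c).

Definition dual (V : vectType k) := 'Hom(V, k^o).
HB.instance Definition _ (V : vectType k) := Vector.on (dual V).

Definition dbas (V : vectType k) (i : 'I_(\dim {:V})) : dual V :=
  linfun (fun v : V => crd i v : k^o).

Lemma dbasE (V : vectType k) (i : 'I_(\dim {:V})) (v : V) : dbas i v = crd i v.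
Proof.
pose g : {linear V -> k^o} := HB.pack (fun v : V => crd i v : k^o)
  (GRing.isLinear.Build _ _ _ _ (fun v : V => crd i v : k^o) (@crdP V i)).
exact: (lfunE g).
Qed.

(* The coalgebra dual to a finite-dimensional algebra A: the coproduct of l is
   the tensor corresponding to the bilinear form (a, b) |-> l (a * b), and its
   counit is evaluation at 1; see comulE and tens_dual_inj. *)
Definition comul (A : falgType k) (l : dual A) : tens (dual A) (dual A) :=
  \sum_i \sum_j l (bas i * bas j) *: pure (dbas i) (dbas j).

Definition counit (A : falgType k) (l : dual A) : k := l 1.

Definition teval (V W : vectType k) (t : tens (dual V) (dual W)) (v : V) (w : W)
  : k := tlift (fun (f : dual V) (g : dual W) => f v * g w : k^o) t.

End TensorProduct.

Section DualCoalgebra.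
Context (k : fieldType).

Lemma eval_bilin (V W : vectType k) (v : V) (w : W) :
  bilin (fun (f : dual V) (g : dual W) => f v * g w : k^o).
Proof.
split=> [f c g h|g c f h] /=; rewrite !lfunE /= lfunE /=.
  by rewrite mulrDr; congr (_ + _); apply: mulrCA.
by rewrite mulrDl; congr (_ + _); rewrite -[LHS]mulrA.
Qed.

Lemma tlift_comul (A : falgType k) (U : lmodType k) (b : dual A -> dual A -> U)
    l : bilin b ->
  tlift b (comul l) = \sum_i \sum_j l (bas i * bas j) *: b (dbas i) (dbas j).
Proof.
move=> bb; pose T : {linear tens (dual A) (dual A) -> U} :=
  HB.pack (tlift b) (GRing.isLinear.Build _ _ _ _ _ (@tlift_linear _ _ _ _ b)).
rewrite -[tlift b]/(T : _ -> _) linear_sum; apply: eq_bigr => i _.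
rewrite linear_sum; apply: eq_bigr => j _.
by rewrite linearZ /= tlift_pure.
Qed.

Lemma comulE (A : falgType k) (l : dual A) (a b : A) :
  teval (comul l) a b = l (a * b).
Proof.
rewrite /teval tlift_comul; last exact: eval_bilin.
rewrite [in RHS](bas_sum a) [in RHS](bas_sum b) mulr_suml linear_sum.
apply: eq_bigr => i _; rewrite mulr_sumr linear_sum; apply: eq_bigr => j _.
rewrite -scalerAl -scalerAr !linearZ /= !dbasE.
by apply: (congr1 ( *%R _)); apply: mulrC.
Qed.

Lemma dual_eq (V : vectType k) (f g : dual V) : (forall v, f v = g v) -> f = g.
Proof. by move=> fg; apply/lfunP. Qed.

Lemma dbas_sum (V : vectType k) (f : dual V) :
  f = \sum_i f (bas i) *: dbas i.
Proof.
apply: dual_eq => v; rewrite sum_lfunE {1}[v]bas_sum linear_sum.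
by apply: eq_bigr => i _; rewrite linearZ lfunE /= dbasE; apply: mulrC.
Qed.

Lemma bilin_dbas (A : falgType k) (U : lmodType k) (b : dual A -> dual A -> U)
    f g : bilin b ->
  b f g = \sum_i \sum_j (f (bas i) * g (bas j)) *: b (dbas i) (dbas j).
Proof.
move=> [br bl].
pose brM v : {linear dual A -> U} :=
  HB.pack (b v) (GRing.isLinear.Build _ _ _ _ (b v) (br v)).
pose blM w : {linear dual A -> U} :=
  HB.pack (b^~ w) (GRing.isLinear.Build _ _ _ _ (b^~ w) (bl w)).
rewrite {1}[f]dbas_sum -[b _ g]/(blM g _) linear_sum; apply: eq_bigr => i _.
rewrite linearZ /= {1}[g]dbas_sum -[b _ (\sum_i _)]/(brM (dbas i) _) linear_sum.
by rewrite scaler_sumr; apply: eq_bigr => j _; rewrite linearZ /= scalerA.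
Qed.

Lemma tens_dual_inj (A : falgType k) (s t : tens (dual A) (dual A)) :
  (forall a b, teval s a b = teval t a b) -> s = t.
Proof.
have dec (u : tens (dual A) (dual A)) :
    u = \sum_i \sum_j teval u (bas i) (bas j) *: pure (dbas i) (dbas j).
  have bp : bilin (@pure k (dual A) (dual A)).
    split=> [f c g h|g c f h]; rewrite /pure.
      by apply/matrixP=> i j; rewrite !mxE crdP mulrDr mulrCA.
    by apply/matrixP=> i j; rewrite !mxE crdP mulrDl mulrA.
  transitivity (tlift (@pure k (dual A) (dual A)) u).
    rewrite [LHS]matrix_sum_delta /tlift; apply: eq_bigr => i _.
    apply: eq_bigr => j _; congr (_ *: _); apply/matrixP=> p q.
    by rewrite !mxE !crd_bas -natrM mulnb.
  rewrite /teval /tlift.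
  under eq_bigr => i _ do under eq_bigr => j _ do
    rewrite (bilin_dbas _ _ bp) scaler_sumr.
  under eq_bigr => i _ do rewrite exchange_big.
  rewrite exchange_big; apply: eq_bigr => p _ /=.
  under eq_bigr => i _ do under eq_bigr => j _ do rewrite scaler_sumr.
  under eq_bigr => i _ do rewrite exchange_big.
  rewrite exchange_big; apply: eq_bigr => q _ /=.
  rewrite scaler_suml; apply: eq_bigr => i _.
  by rewrite scaler_suml; apply: eq_bigr => j _; rewrite scalerA.
move=> st; rewrite (dec s) (dec t); apply: eq_bigr => i _.
by apply: eq_bigr => j _; rewrite st.
Qed.

Lemma comul_linear (A : falgType k) : linear (@comul k A).
Proof.
move=> c f g; apply: tens_dual_inj => a b.
rewrite /teval tlift_linear -!/(teval _ _ _) !comulE.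
by rewrite !lfunE /= !lfunE.
Qed.

Lemma counit_linear (A : falgType k) : linear (@counit k A : dual A -> k^o).
Proof. by move=> c f g; rewrite /counit !lfunE /= lfunE. Qed.

Lemma comul_counitl (A : falgType k) (U : lmodType k) (b : dual A -> U) l :
  linear b -> tlift (fun l' l'' => counit l' *: b l'') (comul l) = b l.
Proof.
move=> lb; pose B : {linear dual A -> U} :=
  HB.pack b (GRing.isLinear.Build _ _ _ _ b lb).
rewrite tlift_comul; last first.
  split=> [f c g h|g c f h]; first by rewrite lb scalerDr !scalerA mulrC.
  by rewrite counit_linear scalerDl scalerA.
rewrite exchange_big [in RHS](dbas_sum l) -[RHS]/(B _) linear_sum.
apply: eq_bigr => j _; rewrite linearZ /= -[in RHS](mul1r (bas j)).
rewrite [in RHS](bas_sum 1) mulr_suml linear_sum.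
rewrite [RHS]scaler_suml.
apply: eq_bigr => i _; rewrite -scalerAl /counit dbasE scalerA mulrC.
by congr (_ *: _); rewrite linearZ.
Qed.

Lemma comul_counitr (A : falgType k) (U : lmodType k) (b : dual A -> U) l :
  linear b -> tlift (fun l' l'' => counit l'' *: b l') (comul l) = b l.
Proof.
move=> lb; pose B : {linear dual A -> U} :=
  HB.pack b (GRing.isLinear.Build _ _ _ _ b lb).
rewrite tlift_comul; last first.
  split=> [f c g h|g c f h]; first by rewrite counit_linear scalerDl scalerA.
  by rewrite lb scalerDr !scalerA mulrC.
rewrite [in RHS](dbas_sum l) -[RHS]/(B _) linear_sum.
apply: eq_bigr => j _; rewrite linearZ /= -[in RHS](mulr1 (bas j)).
rewrite [in RHS](bas_sum 1) mulr_sumr linear_sum.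
rewrite [RHS]scaler_suml.
apply: eq_bigr => i _; rewrite -scalerAr /counit dbasE scalerA mulrC.
by congr (_ *: _); rewrite linearZ.
Qed.

Lemma comul_coassoc (A : falgType k) (U : lmodType k)
    (b : dual A -> dual A -> dual A -> U) l :
  (forall f g, linear (b f g)) -> (forall f h, linear (b f ^~ h)) ->
  (forall g h, linear (fun f => b f g h)) ->
  tlift (fun f g => tlift (b f) (comul g)) (comul l) =
  tlift (fun f h => tlift (fun f' g => b f' g h) (comul f)) (comul l).
Proof.
move=> b3 b2 b1.
rewrite [LHS]tlift_comul; last first.
  split=> [f c g h|g c f h]; first by rewrite comul_linear tlift_linear.
  rewrite /tlift scaler_sumr -big_split; apply: eq_bigr => i _ /=.
  rewrite scaler_sumr -big_split; apply: eq_bigr => j _ /=.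
  by rewrite b1 scalerDr !scalerA mulrC.
rewrite [RHS]tlift_comul; last first.
  split=> [f c g h|g c f h]; last by rewrite comul_linear tlift_linear.
  rewrite /tlift scaler_sumr -big_split; apply: eq_bigr => i _ /=.
  rewrite scaler_sumr -big_split; apply: eq_bigr => j _ /=.
  by rewrite b3 scalerDr !scalerA mulrC.
transitivity (\sum_i \sum_p \sum_q
    l (bas i * bas p * bas q) *: b (dbas i) (dbas p) (dbas q)).
  apply: eq_bigr => i _.
  under eq_bigr => j _ do rewrite tlift_comul // scaler_sumr.
  rewrite exchange_big; apply: eq_bigr => p _.
  under eq_bigr => j _ do rewrite scaler_sumr.
  rewrite exchange_big; apply: eq_bigr => q _ /=.
  rewrite -mulrA [in RHS](bas_sum (bas p * bas q)) mulr_sumr linear_sum.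
  rewrite scaler_suml; apply: eq_bigr => j _.
  rewrite -scalerAr dbasE scalerA mulrC.
  by congr (_ *: _); rewrite linearZ.
symmetry; rewrite exchange_big.
under [LHS]eq_bigr => j _ do
  under eq_bigr => i _ do rewrite tlift_comul // scaler_sumr.
under [LHS]eq_bigr => j _ do rewrite exchange_big.
rewrite exchange_big; apply: eq_bigr => p _ /=.
under [LHS]eq_bigr => j _ do under eq_bigr => i _ do rewrite scaler_sumr.
under [LHS]eq_bigr => j _ do rewrite exchange_big.
rewrite exchange_big; apply: eq_bigr => q _ /=.
apply: eq_bigr => r _.
rewrite [in RHS](bas_sum (bas p * bas q)) mulr_suml linear_sum.
rewrite scaler_suml; apply: eq_bigr => j _.
rewrite -scalerAl dbasE scalerA mulrC.
  by congr (_ *: _); rewrite linearZ.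
Qed.

End DualCoalgebra.

(* T(V) is the free algebra on the basis of V: words in the basis vectors
   stand for their tensor products.  talg_lift, talg_liftP and talg_ext give
   its universal property. *)
Definition talg (k : fieldType) (V : vectType k) : Type :=
  {malg k[{fmonom 'I_(\dim {:V})}]}.

(* The operations of talg V are those of {malg _[_]}, locked because failing
   conversions between sums or products in {malg _[_]} are very slow. *)
Section TensorAlgebraStructure.
Context (k : fieldType) (V : vectType k).
Local Notation M := {malg k[{fmonom 'I_(\dim {:V})}]}.

HB.instance Definition _ := Choice.copy (talg V) M.

Definition talg_opp : talg V -> talg V := locked (fun s : M => - s).
Definition talg_add : talg V -> talg V -> talg V :=
  locked (fun s t : M => s + t).
Definition talg_mul : talg V -> talg V -> talg V :=
  locked (fun s t : M => s * t).
Definition talg_scale : k -> talg V -> talg V :=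
  locked (fun c (t : M) => c *: t).
Definition talg_zero : talg V := locked (0 : M).
Definition talg_one : talg V := locked (1 : M).

Fact talg_addA : associative talg_add.
Proof. by rewrite /talg_add -lock => s t r; apply: addrA. Qed.
Fact talg_addC : commutative talg_add.
Proof. by rewrite /talg_add -lock => s t; apply: addrC. Qed.
Fact talg_add0 : left_id talg_zero talg_add.
Proof. by rewrite /talg_add /talg_zero -!lock => s; apply: add0r. Qed.
Fact talg_addN : left_inverse talg_zero talg_opp talg_add.
Proof.
by rewrite /talg_add /talg_zero /talg_opp -!lock => s; apply: addNr.
Qed.
HB.instance Definition _ :=
  GRing.isZmodule.Build (talg V) talg_addA talg_addC talg_add0 talg_addN.

Fact talg_addE (s t : talg V) : s + t = ((s : M) + (t : M) : M).
Proof. by rewrite /GRing.add /= /talg_add -lock. Qed.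

Fact talg_mulA : associative talg_mul.
Proof. by rewrite /talg_mul -lock => s t r; apply: mulrA. Qed.
Fact talg_mul1l : left_id talg_one talg_mul.
Proof. by rewrite /talg_mul /talg_one -!lock => s; apply: mul1r. Qed.
Fact talg_mul1r : right_id talg_one talg_mul.
Proof. by rewrite /talg_mul /talg_one -!lock => s; apply: mulr1. Qed.
Fact talg_mulDl : left_distributive talg_mul +%R.
Proof. by move=> s t r; rewrite !talg_addE /talg_mul -lock; apply: mulrDl. Qed.
Fact talg_mulDr : right_distributive talg_mul +%R.
Proof. by move=> s t r; rewrite !talg_addE /talg_mul -lock; apply: mulrDr. Qed.
Fact talg_one_neq0 : talg_one != 0.
Proof.
rewrite -[0]/talg_zero /talg_one /talg_zero -!lock; exact: (oner_neq0 M).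
Qed.
HB.instance Definition _ := GRing.Zmodule_isNzRing.Build (talg V)
  talg_mulA talg_mul1l talg_mul1r talg_mulDl talg_mulDr talg_one_neq0.

Fact talg_scaleA c d (t : talg V) :
  talg_scale c (talg_scale d t) = talg_scale (c * d) t.
Proof. by rewrite /talg_scale -lock; apply: scalerA. Qed.
Fact talg_scale1 : left_id 1 talg_scale.
Proof. by rewrite /talg_scale -lock => t; apply: scale1r. Qed.
Fact talg_scaleDr : right_distributive talg_scale +%R.
Proof. by move=> c s t; rewrite !talg_addE /talg_scale -lock; apply: scalerDr. Qed.
Fact talg_scaleDl (t : talg V) : {morph talg_scale^~ t : c d / c + d}.
Proof. by move=> c d; rewrite !talg_addE /talg_scale -lock; apply: scalerDl. Qed.
HB.instance Definition _ := GRing.Zmodule_isLmodule.Build k (talg V)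
  talg_scaleA talg_scale1 talg_scaleDr talg_scaleDl.

Fact talg_scaleE c (t : talg V) : c *: t = (c *: (t : M) : M).
Proof. by rewrite -[LHS]/(talg_scale c t) /talg_scale -lock. Qed.

Fact talg_mulE (s t : talg V) : s * t = ((s : M) * (t : M) : M).
Proof. by rewrite -[LHS]/(talg_mul s t) /talg_mul -lock. Qed.

Fact talg_oneE : 1 = (1 : M) :> talg V.
Proof. by rewrite -[LHS]/talg_one /talg_one -lock. Qed.

Fact talg_zeroE : 0 = (0 : M) :> talg V.
Proof. by rewrite -[LHS]/talg_zero /talg_zero -lock. Qed.

Fact talg_scaleAl c (s t : talg V) : c *: (s * t) = c *: s * t.
Proof. by rewrite !talg_scaleE !talg_mulE; apply: scalerAl. Qed.
HB.instance Definition _ :=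
  GRing.Lmodule_isLalgebra.Build k (talg V) talg_scaleAl.

Fact malgAr c (s t : M) : c *: (s * t) = s * (c *: t).
Proof.
have cC : c%:MP * s = s * c%:MP.
  rewrite [LHS]malgM_def [RHS]malgM_def fgmulUg fgmulgU; apply: eq_bigr => u _.
  by rewrite mul1m mulm1 mulrC.
rewrite -[LHS]mul_malgC -[in RHS]mul_malgC [LHS]mulrA [RHS]mulrA cC.
reflexivity.
Qed.

Fact talgAr c (s t : talg V) : c *: (s * t) = s * (c *: t).
Proof. by rewrite !talg_scaleE !talg_mulE; apply: malgAr. Qed.
HB.instance Definition _ := GRing.Lalgebra_isAlgebra.Build k (talg V) talgAr.

Fact malg_sumE (t : M) : t = \sum_(w <- msupp t) t@_w *: << w >>.
Proof.
rewrite {1}[t]monalgE; apply: eq_bigr => w _; apply/malgP => u.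
by rewrite mcoeffZ [LHS]mcoeffU [X in _ * X]mcoeffU mulr_natr.
Qed.

Fact talg_sumE (I : Type) (r : seq I) (F : I -> talg V) :
  \sum_(i <- r) F i = (\sum_(i <- r) (F i : M) : M).
Proof. by elim/big_ind2: _ => [|s s' t t' -> ->|//]; rewrite (talg_zeroE, talg_addE). Qed.

End TensorAlgebraStructure.

Section TensorAlgebra.
Context (k : fieldType).

Definition word (V : vectType k) (w : seq 'I_(\dim {:V})) : talg V :=
  locked (<< FMonom w >> : {malg k[{fmonom 'I_(\dim {:V})}]}).

Definition tinj (V : vectType k) (v : V) : talg V :=
  \sum_i crd i v *: word [:: i].

(* T_n(V), the span of the words of length at most n. *)
Definition talg_le (V : vectType k) (n : nat) : set (talg V) :=
  [set t : talg V | forall w : {fmonom _}, w \in msupp t -> (size w <= n)%N].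

(* The linear extension to T(V) of a map g defined on words. *)
Definition lext (V : vectType k) (U : lmodType k)
    (g : seq 'I_(\dim {:V}) -> U) (t : talg V) : U :=
  \sum_(w <- msupp t) t@_w *: g w.

Lemma lextE (V : vectType k) (U : lmodType k) g (t : talg V) :
  @lext V U g t = \sum_(w <- msupp t) t@_w *: g w.
Proof. by []. Qed.

Lemma lextEw (V : vectType k) (U : lmodType k) (g : seq 'I_(\dim {:V}) -> U)
    (d : {fset {fmonom 'I_(\dim {:V})}}) (t : talg V) :
  (msupp t `<=` d)%fset -> lext g t = \sum_(w <- d) t@_w *: g w.
Proof.
move=> le; rewrite /lext (big_fset_incl _ le) //= => w _ /mcoeff_outdom ->.
by rewrite scale0r.
Qed.

Lemma lext_linear (V : vectType k) (U : lmodType k) g : linear (@lext V U g).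
Proof.
move=> c s t; pose d := (msupp s `|` msupp t)%fset.
rewrite (@lextEw _ _ g d s) ?fsubsetUl // (@lextEw _ _ g d t) ?fsubsetUr //.
rewrite talg_addE talg_scaleE (@lextEw _ _ g d).
  rewrite scaler_sumr -big_split /=; apply: eq_bigr => w _.
  by rewrite mcoeffD mcoeffZ scalerDl scalerA.
apply: fsubset_trans (msuppD_le _ _) _.
by apply: fsetSU; apply: msuppZ_le.
Qed.

HB.instance Definition _ (V : vectType k) (U : lmodType k) g :=
  GRing.isLinear.Build k (talg V) U *:%R (@lext V U g) (@lext_linear V U g).

Lemma lext_word (V : vectType k) (U : lmodType k) g w :
  @lext V U g (word w) = g w.
Proof. by rewrite /lext /word -lock msuppU1 big_seq_fset1 mcoeffUU scale1r. Qed.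

Lemma talgE (V : vectType k) (t : talg V) : t = lext (@word V) t.
Proof.
rewrite {1}[t]malg_sumE lextE talg_sumE; apply: eq_bigr => -[w] _.
by rewrite talg_scaleE /word -lock.
Qed.

(* A linear map on T(V) is determined by its values on words. *)
Lemma lext_uniq (V : vectType k) (U : lmodType k) (f : talg V -> U) g :
  linear f -> (forall w, f (word w) = g w) -> forall t, f t = lext g t.
Proof.
move=> lf fg t; pose F : {linear talg V -> U} :=
  HB.pack f (GRing.isLinear.Build _ _ _ _ f lf).
rewrite {1}[t]talgE -[f _]/(F _) linear_sum; apply: eq_bigr => -[w] _.
by rewrite linearZ /= fg.
Qed.

Lemma word_nil (V : vectType k) : word [::] = 1 :> talg V.
Proof. by rewrite /word -lock talg_oneE; congr << _ >>; rewrite -fmoneE. Qed.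

Lemma word_cat (V : vectType k) u v :
  word (u ++ v) = word u * word v :> talg V.
Proof.
rewrite /word talg_mulE -!lock [RHS]malgM_def fgmulUU mulr1; congr << _ >>.
by rewrite -[RHS]/(fmmul _ _) fmmulE.
Qed.

Lemma word_cons (V : vectType k) i (w : seq 'I_(\dim {:V})) :
  word (i :: w) = tinj (bas i) * word w.
Proof.
rewrite -cat1s word_cat; congr (_ * _); rewrite /tinj (bigD1 i) //=.
rewrite crd_bas eqxx scale1r big1 ?addr0 // => j ji.
by rewrite crd_bas (negbTE ji) scale0r.
Qed.

Lemma tinj_linear (V : vectType k) : linear (@tinj V).
Proof.
move=> c u v; rewrite /tinj scaler_sumr -big_split; apply: eq_bigr => i _.
by rewrite crdP scalerDl scalerA.
Qed.

HB.instance Definition _ (V : vectType k) :=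
  GRing.isLinear.Build k V (talg V) *:%R (@tinj V) (@tinj_linear V).

(* The algebra morphism extending a linear map f : V -> A. *)
Definition talg_lift (V : vectType k) (A : algType k) (f : V -> A) :
    talg V -> A :=
  lext (fun w => \prod_(i <- w) f (bas i)).

Lemma lextM (V : vectType k) (A : algType k) g :
  (forall u v, g (u ++ v) = g u * g v) ->
  {morph @lext V A g : s t / s * t}.
Proof.
move=> gM s t.
have gMl u : lext g (word u * t) = g u * lext g t.
  rewrite (@lext_uniq _ _ (fun r => lext g (word u * r)) (fun v => g u * g v)).
  - by rewrite /lext mulr_sumr; apply: eq_bigr => v _; rewrite scalerAr.
  - by move=> c r r'; rewrite mulrDr -scalerAr linearP.
  - by move=> v; rewrite -word_cat lext_word gM.
rewrite (@lext_uniq _ _ (fun r => lext g (r * t)) (fun u => g u * lext g t)).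
- by rewrite /lext mulr_suml; apply: eq_bigr => v _; rewrite scalerAl.
- by move=> c r r'; rewrite mulrDl -scalerAl linearP.
- by move=> u; rewrite gMl.
Qed.

Lemma lext_cons (V : vectType k) (U : lmodType k) g v (t : talg V) :
  @lext V U g (tinj v * t) = \sum_i crd i v *: lext (fun w => g (i :: w)) t.
Proof.
rewrite /tinj mulr_suml linear_sum; apply: eq_bigr => i _.
rewrite -scalerAl linearZ /=; congr (_ *: _).
rewrite (@lext_uniq _ _ (fun r => lext g (word [:: i] * r))
  (fun w => g (i :: w))) // => [c r r'|w].
  by rewrite mulrDr -scalerAr linearP.
by rewrite -word_cat lext_word.
Qed.

Lemma lext_1 (V : vectType k) (U : lmodType k) g : @lext V U g 1 = g [::].
Proof. by rewrite -word_nil lext_word. Qed.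

Lemma eq_lext (V : vectType k) (U : lmodType k) g h :
  g =1 h -> @lext V U g =1 lext h.
Proof. by move=> gh t; apply: eq_bigr => w _; rewrite gh. Qed.

Lemma lext_lincomb (V : vectType k) (U : lmodType k) g h c t :
  @lext V U (fun w => c *: g w + h w) t = c *: lext g t + lext h t.
Proof.
rewrite /lext scaler_sumr -big_split; apply: eq_bigr => w _ /=.
by rewrite scalerDr !scalerA mulrC.
Qed.

Lemma lin_lext (V : vectType k) (U U' : lmodType k) (f : U -> U') g t :
  linear f -> f (@lext V U g t) = lext (fun w => f (g w)) t.
Proof.
move=> lf; pose F : {linear U -> U'} :=
  HB.pack f (GRing.isLinear.Build _ _ _ _ f lf).
rewrite -[LHS]/(F _) linear_sum; apply: eq_bigr => w _.
by rewrite linearZ.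
Qed.

Lemma linMr (A : algType k) (a : A) : linear ( *%R a).
Proof. by move=> c s t; rewrite mulrDr scalerAr. Qed.

Lemma linMl (A : algType k) (a : A) : linear (fun s => s * a).
Proof. by move=> c s t; rewrite mulrDl scalerAl. Qed.

Lemma lext_tlift (V W W' : vectType k) (U : lmodType k) B (t : talg V)
    (r : tens W W') :
  lext (fun w => @tlift k W W' U (B w) r) t =
  tlift (fun a b => lext (fun w => B w a b) t) r.
Proof.
rewrite /lext /tlift; under eq_bigr => w _ do rewrite scaler_sumr.
rewrite exchange_big; apply: eq_bigr => i _.
under eq_bigr => w _ do rewrite scaler_sumr.
rewrite exchange_big; apply: eq_bigr => j _ /=.
by rewrite scaler_sumr; apply: eq_bigr => w _; rewrite !scalerA mulrC.
Qed.

Lemma lext0 (V : vectType k) (U : lmodType k) (t : talg V) :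
  lext (fun=> 0 : U) t = 0.
Proof. by apply: big1 => w _; rewrite scaler0. Qed.

Lemma talg_leP (V : vectType k) n c (s t : talg V) :
  talg_le n s -> talg_le n t -> talg_le n (c *: s + t).
Proof.
rewrite talg_addE talg_scaleE => ns nt w wst.
have := fsubsetP (msuppD_le _ _) _ wst; rewrite in_fsetU => /orP[ws|]; last exact: nt.
exact/ns/(fsubsetP (msuppZ_le _ _) _ ws).
Qed.

Lemma talg_le0 (V : vectType k) n : @talg_le V n 0.
Proof. by move=> w; rewrite talg_zeroE msupp0. Qed.

Lemma talg_le_sum (V : vectType k) n (I : Type) (r : seq I) (P : pred I)
    (c : I -> k) (F : I -> talg V) :
  (forall i, P i -> talg_le n (F i)) ->
  talg_le n (\sum_(i <- r | P i) c i *: F i).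
Proof.
move=> nF; elim/big_rec: _ => [|i t Pi nt]; first exact: talg_le0.
exact: talg_leP (nF i Pi) nt.
Qed.

Lemma talg_le_word (V : vectType k) n (w : seq 'I_(\dim {:V})) :
  (size w <= n)%N -> talg_le n (word w).
Proof. by move=> wn u; rewrite /word -lock msuppU1 in_fset1 => /eqP->. Qed.

Lemma talg_le_tinjM (V : vectType k) n v (t : talg V) :
  talg_le n t -> talg_le n.+1 (tinj v * t).
Proof.
move=> nt; rewrite [_ * _]talgE lext_cons; apply: talg_le_sum => i _.
rewrite /lext big_seq; apply: talg_le_sum => w wt.
by apply: talg_le_word; rewrite /= ltnS nt.
Qed.

Lemma talg_liftP (V : vectType k) (A : algType k) (f : V -> A) : linear f ->
  [/\ linear (talg_lift f), talg_lift f 1 = 1,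
      {morph talg_lift f : s t / s * t} &
      forall v, talg_lift f (tinj v) = f v].
Proof.
move=> lf; split; first exact: lext_linear.
- by rewrite -word_nil /talg_lift lext_word big_nil.
- by apply: lextM => u v; rewrite big_cat.
move=> v; pose F : {linear V -> A} :=
  HB.pack f (GRing.isLinear.Build _ _ _ _ f lf).
rewrite {2}[v]bas_sum -[f _]/(F _) linear_sum /tinj /talg_lift linear_sum.
by apply: eq_bigr => i _; rewrite !linearZ /= lext_word big_seq1.
Qed.

Lemma talg_ext (V : vectType k) (A : algType k) (f g : talg V -> A) :
  linear f -> f 1 = 1 -> {morph f : s t / s * t} ->
  linear g -> g 1 = 1 -> {morph g : s t / s * t} ->
  (forall v, f (tinj v) = g (tinj v)) -> f =1 g.
Proof.
move=> lf f1 fM lg g1 gM fg t.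
rewrite (lext_uniq (g := f \o @word V) lf) //.
rewrite (lext_uniq (g := f \o @word V) lg) //.
elim=> [|i w IHw] /=; first by rewrite word_nil f1 g1.
by rewrite word_cons fM gM fg IHw.
Qed.

End TensorAlgebra.

Section Duality.
Context (k : fieldType) (K : falgType k).

Implicit Types (s : talg K) (t : talg (dual K)).

(* The pairing of T(K) with T(K^* ), degree by degree and factor by factor. *)
Fixpoint pair_word (u : seq 'I_(\dim {:K})) (w : seq 'I_(\dim {:dual K})) : k :=
  match u, w with
  | [::], [::] => 1
  | i :: u', j :: w' => (bas j : dual K) (bas i) * pair_word u' w'
  | _, _ => 0
  end.

Definition pairing s t : k :=
  lext (fun u => lext (fun w => pair_word u w : k^o) t) s.

(* The product of the algebras K^{(x) i}: factor by factor in each degree, and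
   zero between different degrees.  It is not the product of talg K. *)
Fixpoint dmul_word (u w : seq 'I_(\dim {:K})) : talg K :=
  match u, w with
  | [::], [::] => 1
  | i :: u', j :: w' => tinj (bas i * bas j) * dmul_word u' w'
  | _, _ => 0
  end.

Definition dmul (s s' : talg K) : talg K :=
  lext (fun u => lext (fun w => dmul_word u w) s') s.

(* The unit of T_n(K), namely the sum of the 1 (x) ... (x) 1 of degree <= n. *)
Definition dunit (n : nat) : talg K := \sum_(i < n.+1) tinj 1 ^+ i.

Definition dsubalg (n : nat) (B : set (talg K)) : Prop :=
  [/\ B `<=` talg_le n, B (dunit n),
      forall c s s', B s -> B s' -> B (c *: s + s') &
      forall s s', B s -> B s' -> B (dmul s s')].

Definition gen_dsubalg (n : nat) (W : set (talg K)) : set (talg K) :=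
  smallest (dsubalg n) W.

(* Orthogonals for the pairing between T_n(K) and T_n(K^* ). *)
Definition orth (n : nat) (Z : set (talg (dual K))) : set (talg K) :=
  [set s | talg_le n s /\ forall t, Z t -> pairing s t = 0].

Definition orthd (n : nat) (B : set (talg K)) : set (talg (dual K)) :=
  [set t | talg_le n t /\ forall s, B s -> pairing s t = 0].

Lemma pairing_linearl t : linear (fun s => pairing s t : k^o).
Proof. exact: lext_linear. Qed.

Lemma pairing_linearr s : linear (fun t => pairing s t : k^o).
Proof.
move=> c t t'; rewrite /pairing -lext_lincomb; apply: eq_lext => u.
exact: lext_linear.
Qed.

Lemma pairing_11 : pairing 1 1 = 1.
Proof. by rewrite /pairing !lext_1. Qed.

Lemma pairing_1M l t : pairing 1 (tinj l * t) = 0.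
Proof.
rewrite /pairing lext_1 lext_cons big1 // => i _.
by rewrite (lext0 k^o) scaler0.
Qed.

Lemma pairing_M1 a s : pairing (tinj a * s) 1 = 0.
Proof.
rewrite /pairing lext_cons big1 // => i _.
rewrite (eq_lext (h := fun=> 0 : k^o)) ?(lext0 k^o) ?scaler0 // => u.
by rewrite lext_1.
Qed.

Lemma pairing_MM a s l t :
  pairing (tinj a * s) (tinj l * t) = l a * pairing s t.
Proof.
pose L u := lext (fun w => pair_word u w : k^o) t.
have step i u : lext (fun w => pair_word (i :: u) w : k^o) (tinj l * t)
    = l (bas i) *: L u.
  rewrite lext_cons (@lin_bas _ _ k^o (fun l : dual K => l (bas i) *: L u)).
    apply: eq_bigr => j _; congr (_ *: _).
    exact: (esym (@lin_lext _ _ k^o k^o _ (pair_word u) t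
      (@linMr _ k^o ((bas j : dual K) (bas i))))).
  by move=> c f g; rewrite !lfunE /= lfunE /= scalerDl scalerA.
rewrite /pairing lext_cons.
rewrite (@lin_bas _ _ k^o (fun a : K => (l a * lext L s : k^o))).
  apply: eq_bigr => i _; rewrite (eq_lext (step i)).
  apply: (congr1 (fun z : k^o => crd i a *: z)).
  exact: (esym (@lin_lext _ _ k^o k^o _ L s (@linMr _ k^o (l (bas i))))).
by move=> c a1 a2; rewrite linearP mulrDl; congr (_ + _); apply: esym (mulrA _ _ _).
Qed.

Lemma dmul_linearl s' : linear (fun s => dmul s s').
Proof. exact: lext_linear. Qed.

Lemma dmul_linearr s : linear (dmul s).
Proof.
move=> c t t'; rewrite /dmul -lext_lincomb; apply: eq_lext => u.
exact: lext_linear.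
Qed.

Lemma dmul_11 : dmul 1 1 = 1.
Proof. by rewrite /dmul !lext_1. Qed.

Lemma dmul_1M b s : dmul 1 (tinj b * s) = 0.
Proof.
by rewrite /dmul lext_1 lext_cons big1 // => i _; rewrite lext0 scaler0.
Qed.

Lemma dmul_M1 a s : dmul (tinj a * s) 1 = 0.
Proof.
rewrite /dmul lext_cons big1 // => i _.
by rewrite (eq_lext (h := fun=> 0)) ?lext0 ?scaler0 // => u; rewrite lext_1.
Qed.

Lemma dmul_MM a s b s' :
  dmul (tinj a * s) (tinj b * s') = tinj (a * b) * dmul s s'.
Proof.
pose L u := lext (dmul_word u) s'.
have step i u : lext (dmul_word (i :: u)) (tinj b * s')
    = tinj (bas i * b) * L u.
  rewrite lext_cons (lin_bas (f := fun b => tinj (bas i * b) * L u)).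
    apply: eq_bigr => j _; apply: (congr1 (GRing.scale _)).
    rewrite /L [RHS](lin_lext _ _ (linMr _)).
    reflexivity.
  by move=> c b1 b2; rewrite (linMr (bas i)) linearP linMl.
rewrite /dmul lext_cons.
rewrite (lin_bas (f := fun a => tinj (a * b) * lext L s)).
  apply: eq_bigr => i _; apply: (congr1 (GRing.scale _)).
  rewrite (eq_lext (step i)).
  rewrite [RHS](lin_lext _ _ (linMr _)).
  reflexivity.
by move=> c a1 a2; rewrite (linMl b) linearP linMl.
Qed.

(* The whole of T_n(K) is a subalgebra, so gen_dsubalg n W is contained in it
   as soon as W is. *)
Lemma dsubalg_talg_le n : dsubalg n (@talg_le k K n).
Proof.
split=> //.
- have tX i : talg_le i (tinj 1 ^+ i : talg K).
    elim: i => [|i IHi]; first by rewrite expr0 -word_nil; apply: talg_le_word.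
    by rewrite exprS; apply: talg_le_tinjM.
  rewrite /dunit; under eq_bigr => i _ do rewrite -[_ ^+ i]scale1r.
  apply: talg_le_sum => i _ w /tX wi.
  by apply: leq_trans wi _; rewrite -ltnS.
- by move=> c s s'; apply: talg_leP.
have dw u w : talg_le (size u) (dmul_word u w).
  elim: u w => [|i u IHu] [|j w] /=; try exact: talg_le0.
    by rewrite -word_nil; apply: talg_le_word.
  exact: talg_le_tinjM.
move=> s s' ns ns'; rewrite /dmul lextE big_seq; apply: talg_le_sum => u us.
rewrite lextE; apply: talg_le_sum => w _ v vw; exact: leq_trans (dw _ _ _ vw) (ns _ us).
Qed.

End Duality.

Section Operators.
Context (k : fieldType) (K E : falgType k).
Variable x : 'Hom(dual K, 'End(dual E)).

(* X(l) on a word f w', by X(l)(f w') = sum X(l')(f) X(l'')(w'). *)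
Fixpoint Xword (w : seq 'I_(\dim {:dual E})) (l : dual K) : talg (dual E) :=
  match w with
  | [::] => counit l *: 1
  | i :: w' => tlift (fun l' l'' => tinj (x l' (bas i)) * Xword w' l'') (comul l)
  end.

(* See Xop_1, Xop_tinj and Xop_mul. *)
Definition Xop (l : dual K) : talg (dual E) -> talg (dual E) :=
  lext (fun w => Xword w l).

(* The unital algebra morphism with value Xop l at l; see pi_x_1,
   pi_x_tinj and pi_x_mul. *)
Definition pi_x (t : talg (dual K)) (w : talg (dual E)) : talg (dual E) :=
  lext (fun u => foldr (fun j => Xop (bas j)) w u) t.

(* The restriction of pi_x t; see pi1_F to E^*. *)
Definition pi1 (t : talg (dual K)) (f : dual E) : talg (dual E) :=
  pi_x t (tinj f).

Definition relations1 (n : nat) : set (talg (dual K)) :=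
  [set t | talg_le n t /\ forall f, pi1 t f = 0].

Definition relations (n : nat) : set (talg (dual K)) :=
  [set t | talg_le n t /\ forall w, pi_x t w = 0].

Lemma Xword_linear w : linear (Xword w).
Proof.
case: w => [|i w] c f g /=; last by rewrite comul_linear tlift_linear.
by rewrite counit_linear scalerDl scalerA.
Qed.

Lemma Xop_linearl w : linear (Xop^~ w).
Proof.
move=> c f g; rewrite /Xop -lext_lincomb; apply: eq_lext => u.
exact: Xword_linear.
Qed.

Lemma Xop_linearr l : linear (Xop l).
Proof. exact: lext_linear. Qed.

Lemma x_linear f : linear (fun l => tinj (x l f)).
Proof. by move=> c l l'; rewrite !(linearP, lfunE) /= !lfunE /= linearP. Qed.

Lemma Xop_1 l : Xop l 1 = counit l *: 1.
Proof. by rewrite /Xop lext_1. Qed.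

Lemma Xop_cons l f w :
  Xop l (tinj f * w) =
  tlift (fun l' l'' => tinj (x l' f) * Xop l'' w) (comul l).
Proof.
rewrite /Xop lext_cons (lin_bas (f := fun f : dual E =>
  tlift (fun l' l'' => tinj (x l' f) * Xop l'' w) (comul l))).
  apply: eq_bigr => i _; congr (_ *: _); rewrite lext_tlift.
  by apply: eq_tlift => p q; rewrite (lin_lext _ _ (linMr _)).
move=> c f1 f2; rewrite -tlift_lincomb; apply: eq_tlift => p q.
by rewrite linearP linearP linMl.
Qed.

Lemma Xop_tinj l f : Xop l (tinj f) = tinj (x l f).
Proof.
rewrite -[tinj f]mulr1 Xop_cons -[RHS](comul_counitr l (x_linear f)).
by apply: eq_tlift => p q; rewrite Xop_1 -scalerAr mulr1.
Qed.

Lemma Xop_mul l s t :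
  Xop l (s * t) = tlift (fun l' l'' => Xop l' s * Xop l'' t) (comul l).
Proof.
have onw u : forall l,
    Xop l (word u * t) =
    tlift (fun l' l'' => Xop l' (word u) * Xop l'' t) (comul l).
  elim: u => [|i u IHu] {}l.
    rewrite word_nil mul1r -[LHS](comul_counitl l (Xop_linearl t)).
    by apply: eq_tlift => p q; rewrite Xop_1 -scalerAl mul1r.
  rewrite word_cons -mulrA Xop_cons.
  transitivity (tlift (fun f g => tlift (fun g' h =>
      tinj (x f (bas i)) * Xop g' (word u) * Xop h t) (comul g)) (comul l)).
    apply: eq_tlift => p q; rewrite IHu (lin_tlift _ _ (linMr _)).
    by apply: eq_tlift => p' q'; rewrite mulrA.
  rewrite comul_coassoc.
  - apply: eq_tlift => p q.
    by rewrite Xop_cons (lin_tlift _ _ (@linMl _ _ _)).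
  - by move=> f g c h h'; rewrite Xop_linearl linMr.
  - by move=> f h c g g'; rewrite Xop_linearl linMr linMl.
  - by move=> g h c f f'; rewrite x_linear !linMl.
rewrite (@lext_uniq _ _ _ (fun r => Xop l (r * t)) (fun u =>
    tlift (fun l' l'' => Xop l' (word u) * Xop l'' t) (comul l))).
- rewrite lext_tlift; apply: eq_tlift => p q.
  rewrite -(lin_lext _ _ (@linMl _ _ (Xop q t))); congr (_ * _).
  by apply: eq_lext => u; rewrite /Xop lext_word.
- by move=> c r r'; rewrite linMl Xop_linearr.
- by move=> u; apply: onw.
Qed.

Lemma pi_x_linearl w : linear (pi_x^~ w).
Proof. exact: lext_linear. Qed.

Lemma pi_word_linear u : linear (fun w => foldr (fun j => Xop (bas j)) w u).
Proof. by elim: u => [|j u IHu] c w w' //=; rewrite IHu Xop_linearr. Qed.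

Lemma pi_x_linearr t : linear (pi_x t).
Proof.
move=> c w w'; rewrite /pi_x -lext_lincomb; apply: eq_lext => u.
exact: pi_word_linear.
Qed.

Lemma pi_x_1 w : pi_x 1 w = w.
Proof. by rewrite /pi_x lext_1. Qed.

Lemma pi_x_tinj l w : pi_x (tinj l) w = Xop l w.
Proof.
rewrite -[tinj l]mulr1 /pi_x lext_cons (lin_bas _ (Xop_linearl w)).
by apply: eq_bigr => j _; rewrite lext_1.
Qed.

Lemma pi_x_mul s t w : pi_x (s * t) w = pi_x s (pi_x t w).
Proof.
rewrite (@lext_uniq _ _ _ (fun r => pi_x (r * t) w)
  (fun u => foldr (fun j => Xop (bas j)) (pi_x t w) u)).
- by [].
- by move=> c r r'; rewrite linMl pi_x_linearl.
elim=> [|j u IHu]; first by rewrite word_nil mul1r.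
rewrite word_cons -mulrA [RHS]/= -IHu {1}/pi_x lext_cons.
rewrite (bigD1 j) //= crd_bas eqxx scale1r big1 ?addr0 => [|i ij]; last first.
  by rewrite crd_bas (negbTE ij) scale0r.
by rewrite [in RHS]/pi_x (lin_lext _ _ (Xop_linearr (bas j))).
Qed.

Lemma pi1_F t f : exists g, pi1 t f = tinj g.
Proof.
exists (lext (fun u => foldr (fun j => x (bas j)) f u) t).
rewrite (lin_lext _ _ (@tinj_linear _ _)); apply: eq_lext => u.
elim: u => [//|j u]; rewrite /= => ->; exact: Xop_tinj.
Qed.

End Operators.

(* Main.v *)
(* By the coproduct t -> sum t' (x) t'' of T_n(L), which is dual to the product
   of T_n(K) and satisfies pi(t)(w w') = sum pi(t')(w) pi(t'')(w'), the
   coefficients of pi(t) on the tensor powers of F are the pairings of t with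
   products of coefficients of pi^1(t).  The latter lie in W_n,
   whence an element orthogonal to B(W_n) is a relation.
   Conversely let M be the orthogonal of the relations.  If s is in W_n, m in M
   and t is a relation, then every sum c(t') t'', with c a coefficient of pi^1,
   is a relation, being a contraction of pi(t); so sum <m,t''> t' lies in R_n^1
   and <s m, t> = 0.  Hence W_n M is contained in M, and so are B(W_n) M and,
   M containing the unit, B(W_n). *)

Require Import Defs.
From HB Require Import structures.
From mathcomp Require Import all_boot all_order all_algebra all_field.
From mathcomp Require Import finmap complex classical_sets boolp reals.
From mathcomp Require Import monalg.

Set Implicit Arguments.
Unset Strict Implicit.
Unset Printing Implicit Defensive.

Import GRing.Theory.

Local Open Scope ring_scope.

(** * Induction on tensors of bounded degree *)

Section TensorAlgebraComplements.
Context (k : fieldType).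

Lemma linear_sumZ (U V : lmodType k) (f : U -> V) (I : Type) (r : seq I)
    (c : I -> k) (F : I -> U) :
  linear f -> f (\sum_(i <- r) c i *: F i) = \sum_(i <- r) c i *: f (F i).
Proof.
move=> lf; pose G : {linear U -> V} :=
  HB.pack f (GRing.isLinear.Build _ _ _ _ f lf).
rewrite -[LHS]/(G _) linear_sum; apply: eq_bigr => i _.
by rewrite linearZ.
Qed.

Lemma linear_0 (U V : lmodType k) (f : U -> V) : linear f -> f 0 = 0.
Proof.
move=> lf; have := linear_sumZ (@nil nat) (fun=> 0) (fun=> 0) lf.
by rewrite !big_nil.
Qed.

Lemma linear_Z (U V : lmodType k) (f : U -> V) c u :
  linear f -> f (c *: u) = c *: f u.
Proof. by move=> lf; rewrite -[c *: u]addr0 lf (linear_0 lf) addr0. Qed.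

Context (V : vectType k).

Lemma talg_le_ind n (P : talg V -> Prop) :
  (forall w, (size w <= n)%N -> P (word w)) ->
  (forall c s t, P s -> P t -> P (c *: s + t)) ->
  forall t, talg_le n t -> P t.
Proof.
move=> Pw PD t nt.
(* The empty word is allowed for every [n], so closure under combinations already yields 0. *)
have P0 : P 0.
  by rewrite -[0](addNr (word [::])) -scaleN1r; apply: (PD); apply: Pw.
rewrite [t]talgE lextE big_seq; elim/big_rec: _ => [//|w s wt Ps].
by apply: PD => //; apply: Pw; apply: nt.
Qed.

Lemma talg_le_exists (t : talg V) : exists n, talg_le n t.
Proof.
pose F (w : {fmonom 'I_(\dim {:V})}) := size w.
exists (\max_(w <- msupp t) F w)%N => w wt.
by rewrite (big_fsetD1 w wt) leq_maxl.
Qed.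

Lemma talg_ind (P : talg V -> Prop) :
  (forall w, P (word w)) ->
  (forall c s t, P s -> P t -> P (c *: s + t)) ->
  forall t, P t.
Proof.
move=> Pw PD t; have [n nt] := talg_le_exists t.
by apply: (@talg_le_ind n P _ PD t nt) => w _; apply: Pw.
Qed.

Lemma talg_leZ n c (t : talg V) : talg_le n t -> talg_le n (c *: t).
Proof.
by move=> nt; rewrite -[c *: t]addr0; apply: talg_leP => //; apply: talg_le0.
Qed.

Lemma talg_le_sumM n (I : finType) (c : I -> k) (v : I -> V) (t : I -> talg V) :
  (forall i, talg_le n (t i)) ->
  talg_le n.+1 (\sum_i c i *: (tinj (v i) * t i)).
Proof. by move=> nt; apply: talg_le_sum => i _; apply: talg_le_tinjM. Qed.

End TensorAlgebraComplements.

(** * Perfectness of the pairing of T_n(K) with T_n(L) *)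

Section DualityComplements.
Context (k : fieldType) (K : falgType k).

Implicit Types (s : talg K) (t : talg (dual K)).

Lemma pairingPl c s s' t :
  pairing (c *: s + s') t = c * pairing s t + pairing s' t.
Proof. exact: pairing_linearl. Qed.

Lemma pairingPr c s t t' :
  pairing s (c *: t + t') = c * pairing s t + pairing s t'.
Proof. exact: pairing_linearr. Qed.

Lemma pairing0l t : pairing 0 t = 0.
Proof. exact: (linear_0 (@pairing_linearl k K t)). Qed.

Lemma pairing0r s : pairing s 0 = 0.
Proof. exact: (linear_0 (@pairing_linearr k K s)). Qed.

Lemma pairingZl c s t : pairing (c *: s) t = c * pairing s t.
Proof. exact: (linear_Z c s (@pairing_linearl k K t)). Qed.

Lemma pairingZr c s t : pairing s (c *: t) = c * pairing s t.
Proof. exact: (linear_Z c t (@pairing_linearr k K s)). Qed.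

Lemma pairing_suml (I : finType) (c : I -> k) (F : I -> talg K) t :
  pairing (\sum_i c i *: F i) t = \sum_i c i * pairing (F i) t.
Proof. exact: (linear_sumZ _ c F (@pairing_linearl k K t)). Qed.

Lemma pairing_sumr (I : finType) (c : I -> k) (F : I -> talg (dual K)) s :
  pairing s (\sum_i c i *: F i) = \sum_i c i * pairing s (F i).
Proof. exact: (linear_sumZ _ c F (@pairing_linearr k K s)). Qed.

(** Peeling off the first tensor factor, the representing element is phi(1) plus the sum of the
    [bas i] (x) s_i, where s_i represents [phi (tinj (dbas i) * t)] one degree lower. *)
Lemma pairing_repr n (phi : talg (dual K) -> k) :
  linear (phi : _ -> k^o) ->
  exists2 s, talg_le n s & forall t, talg_le n t -> pairing s t = phi t.
Proof.
elim: n phi => [|n IHn] phi lphi.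
  exists (phi 1 *: 1 : talg K).
    by apply: talg_leZ; rewrite -word_nil; apply: talg_le_word.
  apply: talg_le_ind => [[|//] _|c t t' IHt IHt'].
    by rewrite word_nil pairingZl pairing_11 mulr1.
  by rewrite pairingPr IHt IHt'; apply: esym (lphi _ _ _).
have /choice[s sP] : forall i : 'I_(\dim {:K}), exists s, talg_le n s /\
    forall t, talg_le n t -> pairing s t = phi (tinj (dbas i) * t).
  move=> i; have [|s ns sE] := IHn (fun t => phi (tinj (dbas i) * t)).
    by move=> c t t'; rewrite (@linMr _ (talg (dual K))) lphi.
  by exists s.
exists (phi 1 *: 1 + \sum_i 1 *: (tinj (bas i) * s i)).
  apply: talg_leP; first by rewrite -word_nil; apply: talg_le_word.
  by apply: talg_le_sumM => i; apply: (sP i).1.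
apply: talg_le_ind => [[|j w] wn|c t t' IHt IHt'].
- rewrite word_nil pairingPl pairing_11 mulr1 pairing_suml big1 ?addr0 // => i _.
  by rewrite pairing_M1 mulr0.
- rewrite word_cons pairingPl pairing_1M mulr0 add0r pairing_suml.
  have sE i : pairing (s i) (word w) = phi (tinj (dbas i) * word w).
    by apply: (sP i).2; apply: talg_le_word.
  under eq_bigr => i _ do rewrite mul1r pairing_MM sE.
  pose g l := phi (tinj l * word w).
  have lg : linear (g : dual K -> k^o).
    by move=> c l l'; rewrite /g linearP linMl lphi.
  (* The letter [bas j] comes from the chosen basis of [dual K], which need not be the dual basis
     [dbas]; hence the expansion. *)
  rewrite -[RHS]/(g (bas j)) [in RHS](dbas_sum (bas j)).
  by rewrite (linear_sumZ _ _ _ lg).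
- by rewrite pairingPr IHt IHt'; apply: esym (lphi _ _ _).
Qed.

Lemma pairing_nondegr t : (forall s, pairing s t = 0) -> t = 0.
Proof.
move=> t0; rewrite [t]talgE lextE big1 // => w _.
have [n nt] := talg_le_exists t.
(* The coordinate form along [w] is linear, hence represented by a pairing, which vanishes on
   [t]. *)
have lphi : linear (lext (fun u => (FMonom u == w)%:R : k^o)
    : talg (dual K) -> k^o) by apply: lext_linear.
have [s _ /(_ t nt)] := pairing_repr n lphi.
rewrite t0 lextE => {lphi} t0w.
suff -> : t@_w = 0 by rewrite scale0r.
have [wt|/mcoeff_outdom //] := boolP (w \in msupp t).
move: t0w; rewrite (big_fsetD1 w) //= big_seq big1 => [|u].
  by case: w wt => w wt; rewrite eqxx addr0 /GRing.scale /= mulr1.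
rewrite in_fsetD1 => /andP[/negbTE uw _]; case: u uw => u uw.
by rewrite uw scaler0.
Qed.

(** * Associativity and unit of T_n(K) *)

Lemma dmulA : associative (@dmul k K).
Proof.
have dm0l s : dmul 0 s = 0 by apply: (linear_0 (@dmul_linearl k K s)).
have dm0r s : dmul s 0 = 0 by apply: (linear_0 (@dmul_linearr k K s)).
move=> s s' s''.
elim/talg_ind: s => [u|c s1 s2 IH1 IH2]; last by rewrite !dmul_linearl IH1 IH2.
elim/talg_ind: s' => [v|c s1 s2 IH1 IH2]; last first.
  by rewrite dmul_linearl !dmul_linearr dmul_linearl IH1 IH2.
elim/talg_ind: s'' => [w|c s1 s2 IH1 IH2]; last by rewrite !dmul_linearr IH1 IH2.
(* Words of unequal lengths give 0 on both sides; otherwise the letters multiply in [K] position by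
   position. *)
elim: u v w => [|i u IHu] [|j v] [|l w]; rewrite ?word_nil ?word_cons.
- by rewrite !dmul_11.
- by rewrite dmul_1M dm0r dmul_11 dmul_1M.
- by rewrite dmul_M1 dm0r dmul_1M dm0l.
- by rewrite dmul_MM !dmul_1M dm0l.
- by rewrite dmul_11 !dmul_M1 dm0l.
- by rewrite dmul_1M dmul_M1 dm0l dm0r.
- by rewrite dmul_M1 dmul_MM dmul_M1 dm0r.
- by rewrite !dmul_MM mulrA IHu.
Qed.

Lemma dunitS n : dunit K n.+1 = 1 + tinj 1 * dunit K n.
Proof.
rewrite /dunit big_ord_recl expr0; congr (_ + _); rewrite mulr_sumr.
by apply: eq_bigr => i _; rewrite exprS.
Qed.

Lemma dunit0 : dunit K 0 = 1.
Proof. by rewrite /dunit big_ord1 expr0. Qed.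

Lemma dmulDl (s1 s2 s : talg K) : dmul (s1 + s2) s = dmul s1 s + dmul s2 s.
Proof. by rewrite -[s1]scale1r dmul_linearl !scale1r. Qed.

Lemma dmulDr (s s1 s2 : talg K) : dmul s (s1 + s2) = dmul s s1 + dmul s s2.
Proof. by rewrite -[s1]scale1r dmul_linearr !scale1r. Qed.

Lemma dmul1l n s : talg_le n s -> dmul (dunit K n) s = s.
Proof.
apply: (@talg_le_ind _ _ n (fun s => dmul (dunit K n) s = s))
    => [w|c s1 s2 IH1 IH2]; last by rewrite dmul_linearr IH1 IH2.
elim: w n => [|i w IHw] [|n] // wn; rewrite ?dunit0 ?dunitS ?word_nil ?word_cons.
- exact: dmul_11.
- by rewrite dmulDl dmul_11 dmul_M1 addr0.
- by rewrite dmulDl dmul_1M dmul_MM mul1r add0r IHw.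
Qed.

Lemma dmul1r n s : talg_le n s -> dmul s (dunit K n) = s.
Proof.
apply: (@talg_le_ind _ _ n (fun s => dmul s (dunit K n) = s))
    => [w|c s1 s2 IH1 IH2]; last by rewrite dmul_linearl IH1 IH2.
elim: w n => [|i w IHw] [|n] // wn; rewrite ?dunit0 ?dunitS ?word_nil ?word_cons.
- exact: dmul_11.
- by rewrite dmulDr dmul_11 dmul_1M addr0.
- by rewrite dmulDr dmul_M1 dmul_MM mulr1 add0r IHw.
Qed.

End DualityComplements.

(** * Coproducts, contractions and coefficients of the operators pi(t) *)

Section OperatorComplements.
Context (k : fieldType) (K E : falgType k).
Variable x : 'Hom(dual K, 'End(dual E)).

Local Notation pi := (pi_x x).

(* A coproduct of t in T_n(K^* ), written as the sum of the p i (x) q i, is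
   recorded by its two defining properties: it is dual to the product of
   T_n(K), and pi is a morphism for it. *)
Definition coproduct_terms n (t : talg (dual K)) (I : finType)
    (p q : I -> talg (dual K)) : Prop :=
  [/\ forall i, talg_le n (p i) /\ talg_le n (q i),
      forall s s',
        pairing (dmul s s') t = \sum_i pairing s (p i) * pairing s' (q i) &
      forall w w', pi t (w * w') = \sum_i pi (p i) w * pi (q i) w'].

Lemma coproduct_terms_1 n : coproduct_terms n 1 (fun _ : unit => 1) (fun=> 1).
Proof.
split=> [_|s s'|w w']; first by rewrite -word_nil; split; apply: talg_le_word.
- rewrite (bigD1 tt) //= big1 ?addr0 => [|[]//].
  elim/talg_ind: s => [u|c s1 s2 IH1 IH2]; last first.
    by rewrite dmul_linearl !pairingPl IH1 IH2 mulrDl mulrA.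
  elim/talg_ind: s' => [v|c s1 s2 IH1 IH2]; last first.
    by rewrite dmul_linearr !pairingPl IH1 IH2 mulrDr mulrCA.
  case: u v => [|i u] [|j v]; rewrite ?word_nil ?word_cons.
  - by rewrite dmul_11 !pairing_11 mulr1.
  - by rewrite dmul_1M pairing0l pairing_M1 mulr0.
  - by rewrite dmul_M1 pairing0l pairing_M1 mul0r.
  - by rewrite dmul_MM !pairing_M1 mulr0.
- by rewrite (bigD1 tt) //= big1 ?addr0 => [|[]//]; rewrite !pi_x_1.
Qed.

(** The coproduct is multiplicative: that of l t is the product of those of l and t, the former
    expanded on the dual basis as in [comul]. An index holds two basis indices and a term of t. *)
Lemma coproduct_terms_cons n l t (I : finType) (p q : I -> talg (dual K)) :
  coproduct_terms n t p q ->
  coproduct_terms n.+1 (tinj l * t)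
    (fun z : 'I_(\dim {:K}) * 'I_(\dim {:K}) * I =>
       (l (bas z.1.1 * bas z.1.2) : k) *:
         (tinj (dbas z.1.1) * p z.2 : talg (dual K)))
    (fun z => tinj (dbas z.1.2) * q z.2).
Proof.
case=> npq dmulE piE; split=> [z|s s'|w w'].
- have [np nq] := npq z.2; split; last exact: talg_le_tinjM.
  by apply: talg_leZ; apply: talg_le_tinjM.
- elim/talg_ind: s => [u|c s1 s2 IH1 IH2]; last first.
    rewrite dmul_linearl pairingPl IH1 IH2 mulr_sumr -big_split /=.
    by apply: eq_bigr => z _; rewrite pairingPl mulrDl mulrA.
  elim/talg_ind: s' => [v|c s1 s2 IH1 IH2]; last first.
    rewrite dmul_linearr pairingPl IH1 IH2 mulr_sumr -big_split /=.
    by apply: eq_bigr => z _; rewrite pairingPl mulrDr mulrCA.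
  case: u v => [|a u] [|b v]; rewrite ?word_nil ?word_cons.
  - rewrite dmul_11 pairing_1M big1 // => z _.
    by rewrite pairingZr pairing_1M mulr0 mul0r.
  - rewrite dmul_1M pairing0l big1 // => z _.
    by rewrite pairingZr pairing_1M mulr0 mul0r.
  - rewrite dmul_M1 pairing0l big1 // => z _.
    by rewrite pairing_1M mulr0.
  rewrite dmul_MM pairing_MM dmulE.
  under [RHS]eq_bigr => z _ do
    rewrite pairingZr !pairing_MM !dbasE !crd_bas.
  rewrite -(pair_bigA _ (fun ab i =>
    l (bas ab.1 * bas ab.2) * ((ab.1 == a)%:R * pairing (word u) (p i)) *
    ((ab.2 == b)%:R * pairing (word v) (q i)))) /=.
  (* By duality of [bas] and [dbas], only the pair [(a, b)] survives. *)
  rewrite (bigD1 (a, b)) //= [X in _ + X]big1 => [|[a' b'] ab]; last first.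
    apply: big1 => i _; move: ab; rewrite xpair_eqE negb_and.
    by case/orP=> /negbTE ->; rewrite !(mul0r, mulr0).
  rewrite addr0 mulr_sumr; apply: eq_bigr => i _.
  by rewrite !eqxx !mul1r mulrA.
- rewrite pi_x_mul pi_x_tinj piE.
  transitivity (\sum_i \sum_(ab : 'I_(\dim {:K}) * 'I_(\dim {:K}))
    (l (bas ab.1 * bas ab.2) : k) *:
      (Xop x (dbas ab.1) (pi (p i) w) * Xop x (dbas ab.2) (pi (q i) w'))).
    under eq_bigr => i _ do rewrite -[_ * _]scale1r.
    rewrite (linear_sumZ _ _ _ (Xop_linearr x l)).
    apply: eq_bigr => i _; rewrite scale1r Xop_mul tlift_comul.
      by rewrite pair_bigA.
    split=> [f c g h|g c f h]; first by rewrite Xop_linearl linMr.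
    by rewrite Xop_linearl linMl.
  rewrite exchange_big pair_bigA; apply: eq_bigr => z _ /=.
  rewrite (linear_Z _ _ (pi_x_linearl x _)) !pi_x_mul !pi_x_tinj.
  exact: scalerAl.
Qed.

Lemma coproduct_terms_lincomb n c t t' (I J : finType)
    (p q : I -> talg (dual K)) (p' q' : J -> talg (dual K)) :
  coproduct_terms n t p q -> coproduct_terms n t' p' q' ->
  coproduct_terms n (c *: t + t')
    (fun z : I + J => match z with inl i => c *: p i | inr j => p' j end)
    (fun z => match z with inl i => q i | inr j => q' j end).
Proof.
case=> npq dmulE piE [npq' dmulE' piE']; split=> [[i|j]|s s'|w w'] //.
- by have [np nq] := npq i; split=> //; apply: talg_leZ.
- rewrite pairingPr dmulE dmulE' big_sumType mulr_sumr; congr (_ + _).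
  by apply: eq_bigr => i _; rewrite pairingZr mulrA.
- rewrite pi_x_linearl piE piE' big_sumType scaler_sumr; congr (_ + _).
  by apply: eq_bigr => i _; rewrite (linear_Z _ _ (pi_x_linearl x _)) scalerAl.
Qed.

Lemma coproduct_exists n t : talg_le n t ->
  exists (I : finType) (p q : I -> talg (dual K)), coproduct_terms n t p q.
Proof.
apply: (@talg_le_ind _ _ n (fun t => exists (I : finType) p q,
  @coproduct_terms n t I p q)) => [w|c s {}t [I [p [q spq]]] [J [p' [q' tpq]]]].
  elim: w n => [|j w IHw] [|n] // wn.
  - by rewrite word_nil; do 3!eexists; apply: coproduct_terms_1.
  - by rewrite word_nil; do 3!eexists; apply: coproduct_terms_1.
  rewrite word_cons; have [I [p [q wpq]]] := IHw n wn.
  by do 3!eexists; apply: coproduct_terms_cons wpq.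
by do 3!eexists; apply: coproduct_terms_lincomb spq tpq.
Qed.

(** Evaluates the first tensor factor at [e]; degree 0, having none, goes to 0. *)
Definition contract (e : E) : talg (dual E) -> talg (dual E) :=
  lext (fun u => match u with
    | [::] => 0
    | i :: u' => ((bas i : dual E) e : k) *: word u'
    end).

Lemma contract_linear e : linear (contract e).
Proof. exact: lext_linear. Qed.

Lemma contract_cons e (g : dual E) w : contract e (tinj g * w) = (g e : k) *: w.
Proof.
rewrite /contract lext_cons (@lin_bas _ _ _ (fun g : dual E => (g e : k) *: w)).
  apply: eq_bigr => i _; congr (_ *: _); rewrite {2}[w]talgE.
  by rewrite (lin_lext _ _ (f := GRing.scale _)) // => c u v; exact: linearP.
by move=> c f f'; rewrite !lfunE /= !lfunE /= scalerDl scalerA.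
Qed.

Lemma pairing_tinj (e : E) (g : dual E) : pairing (tinj e) (tinj g) = g e.
Proof. by rewrite -[tinj e]mulr1 -[tinj g]mulr1 pairing_MM pairing_11 mulr1. Qed.

(** Both sides are the counit of [t]: a letter l contributes l(1), either against [tinj 1] or
    through X(l)(1). *)
Lemma dunit_pairing n t : talg_le n t -> pairing (dunit K n) t *: 1 = pi t 1.
Proof.
apply: (@talg_le_ind _ _ n (fun t => pairing (dunit K n) t *: 1 = pi t 1))
    => [w|c s1 s2 IH1 IH2]; last first.
  by rewrite pairingPr pi_x_linearl -IH1 -IH2 scalerDl scalerA.
elim: w n => [|i w IHw] [|n] // wn; rewrite ?word_nil ?word_cons.
- by rewrite dunit0 pairing_11 pi_x_1 scale1r.
- rewrite dunitS -[X in X + _]scale1r pairingPl pairing_11 pairing_M1 addr0.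
  by rewrite mulr1 pi_x_1 scale1r.
- rewrite dunitS -[X in X + _]scale1r pairingPl pairing_1M mulr0 add0r.
  rewrite pairing_MM pi_x_mul pi_x_tinj -(IHw n) //.
  by rewrite (linear_Z _ _ (Xop_linearr x _)) Xop_1 scalerA mulrC.
Qed.

(** Since <s m, t> is the sum of the <s, p i><m, q i>, it suffices that the sum of the <m, q i> p i
    lies in R_n^1. *)
Lemma dmul_orth n s m :
  orth n (relations1 x n) s -> orth n (relations x n) m ->
  orth n (relations x n) (dmul s m).
Proof.
move=> [ns s0] [nm m0]; have [_ _ _ dmulT] := dsubalg_talg_le K n.
split=> [|t [nt t0]]; first exact: dmulT.
have [I [p [q [npq dmulE piE]]]] := coproduct_exists nt.
rewrite dmulE; under eq_bigr => i _ do rewrite mulrC.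
rewrite -pairing_sumr; apply: s0; split=> [|f].
  by apply: talg_le_sum => i _; have [] := npq i.
rewrite /pi1 (linear_sumZ _ _ _ (pi_x_linearl x _)).
have /choice[g gE] i : exists g, pi (p i) (tinj f) = tinj g by apply: pi1_F.
under eq_bigr => i _ do rewrite gE.
rewrite -(linear_sumZ _ _ _ (@tinj_linear _ (dual E))).
suff -> : \sum_i pairing m (q i) *: g i = 0 by rewrite linear0.
(* Evaluated at [e], the sum is the pairing of [m] with the sum of the g_i(e) q_i, so this element
   is to be shown a relation. *)
apply: dual_eq => e; rewrite sum_lfunE lfunE /=.
transitivity (pairing m (\sum_i (g i e : k) *: q i)).
  by rewrite pairing_sumr; apply: eq_bigr => i _; rewrite lfunE mulrC.
apply: m0; split=> [|w]; first by apply: talg_le_sum => i _; have [] := npq i.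
rewrite (linear_sumZ _ _ _ (pi_x_linearl x _)).
(* Its action on [w] is a contraction of [pi t], which is zero. *)
transitivity (contract e (pi t (tinj f * w))); last first.
  by rewrite t0 (linear_0 (contract_linear e)).
rewrite piE; under [in RHS]eq_bigr => i _ do rewrite -[_ * _]scale1r.
rewrite (linear_sumZ _ _ _ (contract_linear e)).
by apply: eq_bigr => i _; rewrite gE contract_cons scale1r.
Qed.

Lemma gen_dsubalg_orth n s :
  gen_dsubalg n (orth n (relations1 x n)) s -> orth n (relations x n) s.
Proof.
have [_ T1 TP TM] := dsubalg_talg_le K n.
(* Minimality is applied to the left multipliers of the orthogonal of the relations; associativity
   makes them stable under products. *)
pose Z : set (talg K) := [set s | talg_le n s /\ forall m,
  orth n (relations x n) m -> orth n (relations x n) (dmul s m)]%classic.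
move=> /(_ Z)[]; first split; first split.
- by move=> ? [].
- by split=> // m mM; rewrite dmul1l //; case: mM.
- move=> c s1 s2 [n1 M1] [n2 M2]; split=> [|m mM]; first exact: TP.
  have [_ m1] := M1 m mM; have [_ m2] := M2 m mM; split=> [|t tR].
    by apply: TM; [apply: TP|case: mM].
  by rewrite dmul_linearl pairingPl m1 // m2 // mulr0 addr0.
- move=> s1 s2 [n1 M1] [n2 M2]; split=> [|m mM]; first exact: TM.
  by rewrite -dmulA; apply/M1/M2.
- by move=> s1 W1; split=> [|m]; [case: W1|apply: dmul_orth].
(* Multiplying the unit returns [s]; the unit is orthogonal to a relation [t] because [pi t 1] is
   zero. *)
move=> ns /(_ (dunit K n)); rewrite dmul1r //; apply; split=> // t [nt t0].
have := dunit_pairing nt; rewrite t0 => /eqP; rewrite scaler_eq0 oner_eq0 orbF.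
by move/eqP.
Qed.

(* The coefficients of pi t along a word v are built from those of degree one,
   which lie in the orthogonal of relations1, by products in T_n(K). *)
Lemma matrix_coefficient n v (a : talg E) :
  exists2 c, gen_dsubalg n (orth n (relations1 x n)) c &
    forall t, talg_le n t -> pairing a (pi t (word v)) = pairing c t.
Proof.
set B := gen_dsubalg _ _.
have [B1 BP BM] : [/\ B (dunit K n),
    forall c s s', B s -> B s' -> B (c *: s + s') &
    forall s s', B s -> B s' -> B (dmul s s')].
  split=> [|c s s' Bs Bs'|s s' Bs Bs'] Z ZP; case: (ZP) => -[_ Z1 ZL ZM] WZ //.
  - by apply: ZL; [apply: Bs|apply: Bs'].
  - by apply: ZM; [apply: Bs|apply: Bs'].
have B0 : B 0 by rewrite -[0](addNr (dunit K n)) -scaleN1r; apply: BP.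
elim: v a => [|j v IHv] a.
  (* On the empty word [pi t] acts by the counit, that is by pairing with the unit. *)
  exists (pairing a 1 *: dunit K n) => [|t nt].
    by rewrite -[_ *: _]addr0; apply: BP.
  by rewrite word_nil -(dunit_pairing nt) pairingZl pairingZr mulrC.
elim/talg_ind: a => [[|i u]|c a1 a2 [c1 Bc1 cE1] [c2 Bc2 cE2]]; last first.
- exists (c *: c1 + c2) => [|t nt]; first exact: BP.
  by rewrite !pairingPl cE1 ?cE2.
- have [c' Bc' c'E] := IHv (word u).
  pose phi t := pairing (tinj (bas i)) (pi t (tinj (bas j))).
  have lphi : linear (phi : _ -> k^o).
    by move=> c t t'; rewrite /phi pi_x_linearl pairingPr.
  have [s ns sE] := pairing_repr n lphi.
  (* The coproduct splits the coefficient into one on the first letter, represented by [s], and one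
     along [v], represented by [c']. *)
  exists (dmul s c') => [|t nt].
    (* The form [phi] factors through [pi1], so [s] lies in W_n. *)
    apply: BM => // Z [_ WZ]; apply: WZ; split=> // t [nt t0].
    by rewrite sE // /phi [pi _ _]t0 pairing0r.
  have [I [p [q [npq dmulE piE]]]] := coproduct_exists nt.
  rewrite !word_cons dmulE piE.
  under eq_bigr => r _ do rewrite -[_ * _]scale1r.
  rewrite pairing_sumr; apply: eq_bigr => r _; have [np nq] := npq r.
  rewrite mul1r -c'E // sE // /phi.
  have [g gE] := pi1_F x (p r) (bas j); rewrite -[pi _ (tinj _)]/(pi1 _ _ _) gE.
  by rewrite pairing_MM pairing_tinj.
(* The first letter is mapped into F, so the image has no component of degree 0 to pair with the
   empty word. *)
- exists 0 => // t nt; rewrite pairing0l word_nil word_cons.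
  have [I [p [q [npq dmulE ->]]]] := coproduct_exists nt.
  under eq_bigr => r _ do rewrite -[_ * _]scale1r.
  rewrite pairing_sumr big1 // => r _.
  have [g gE] := pi1_F x (p r) (bas j); rewrite -[pi _ (tinj _)]/(pi1 _ _ _) gE.
  by rewrite pairing_1M mulr0.
Qed.

(** If [t] is orthogonal to B(W_n), all coefficients of [pi t] on words vanish, and the pairing on
    T(F) is nondegenerate; the other inclusion is [gen_dsubalg_orth]. *)
Lemma orthd_gen_dsubalg n :
  orthd n (gen_dsubalg n (orth n (relations1 x n))) = relations x n.
Proof.
apply/predeqP => t; split=> [[nt t0]|tR]; last first.
  by split=> [|s /gen_dsubalg_orth[_ ->] //]; case: tR.
split=> // w; elim/talg_ind: w => [v|c w w' IHw IHw'].
  apply: pairing_nondegr => a.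
  by have [c Bc ->] := matrix_coefficient n v a; rewrite ?t0.
by rewrite pi_x_linearr IHw IHw' scaler0 addr0.
Qed.

End OperatorComplements.

Theorem mainTheorem4 (R : realType) (K E : falgType R[i])
    (x : 'Hom(dual K, 'End(dual E)))
    (hx : forall l : dual K, invd (@comul _ E) (x l)) (n : nat) :
  orthd n (gen_dsubalg n (orth n (relations1 x n))) = relations x n.
Proof. exact: orthd_gen_dsubalg. Qed.
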